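(* Let $g:[0,1]\to[0,1]$ be a piecewise linear unimodal map which is topologically conjugate to the tent map $f$, and let $h:[0,1]\to[0,1]$ be the conjugacy, i.e. a homeomorphism with $h\circ f=g\circ h$. If there exists a non-trivial piecewise linear commutator of $g$, then the conjugacy $h$ is piecewise linear.
   Context: A continuous map $g:[0,1]\to[0,1]$ is called unimodal if there is $v\in(0,1)$ such that $g$ is (strictly) increasing on $[0,v]$, (strictly) decreasing on $[v,1]$, and $g(0)=g(1)=0$, $g(v)=1$. The tent map is $f:[0,1]\to[0,1]$, $f(x)=1-|1-2x|$. Piecewise linear means continuous and affine on each of finitely many intervals whose union is $[0,1]$. A non-trivial piecewise linear commutator of $g$ is a continuous piecewise linear map $\psi:[0,1]\to[0,1]$ such that $g\circ\psi=\psi\circ g$ and $\psi$ is neither a constant map nor an iterate $g^n$ of $g$, $n\ge 0$ (with $g^0=\mathrm{id}$). *)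

(* Defs.v *)
From mathcomp Require Export all_boot all_order all_algebra.
From mathcomp Require Export all_classical all_reals all_analysis.
Export numFieldNormedType.Exports.

Set Implicit Arguments.
Unset Strict Implicit.
Unset Printing Implicit Defensive.

Import Order.TTheory GRing.Theory Num.Theory.

Local Open Scope classical_set_scope.
Local Open Scope ring_scope.

(* A map from [0, 1] to [0, 1] is represented by a function R -> R that
   preserves `[0, 1]; its values outside `[0, 1] are irrelevant in every
   definition below. *)
Section UnitIntervalMaps.
Variable R : realType.
Implicit Types f g h psi : R -> R.

Definition unit_continuous_map f : Prop :=
  set_fun `[0, 1] `[0, 1] f /\ {within `[0, 1], continuous f}.

Definition tent (x : R) : R := 1 - `|1 - 2 * x|.

Definition unimodal g : Prop :=
  unit_continuous_map g /\
  exists v : R,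
    [/\ v \in `]0, 1[,
        {in `[0, v] &, {homo g : x y / x < y}},
        {in `[v, 1] &, {homo g : x y /~ x < y}},
        g 0 = 0 /\ g 1 = 0
      & g v = 1].

(* The intervals may be open, closed or half-open, and may overlap. *)
Definition piecewise_linear f : Prop :=
  {within `[0, 1], continuous f} /\
  exists s : seq (interval R),
    (forall x : R, (x \in `[0, 1]) = has (fun i : interval R => x \in i) s) /\
    (forall i : interval R, i \in s ->
       exists a b : R, {in i, forall x, f x = a * x + b}).

Definition unit_homeomorphism h : Prop :=
  unit_continuous_map h /\
  exists k : R -> R,
    [/\ unit_continuous_map k,
        {in `[0, 1], cancel h k}
      & {in `[0, 1], cancel k h}].

Definition conjugates_tent h g : Prop :=
  unit_homeomorphism h /\ {in `[0, 1], forall x, h (tent x) = g (h x)}.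

Definition nontrivial_pl_commutator g psi : Prop :=
  [/\ unit_continuous_map psi,
      piecewise_linear psi,
      {in `[0, 1], forall x, g (psi x) = psi (g x)},
      ~ (exists c : R, {in `[0, 1], forall x, psi x = c})
    & ~ (exists n : nat, {in `[0, 1], forall x, psi x = iter n g x})].

End UnitIntervalMaps.

(* Main.v *)
Require Import Defs.
From mathcomp Require Import zify ring lra.

(** The map [phi = k \o psi \o h], where [k] is the inverse of [h], commutes
    with the tent map, so both [g] and [psi] can be studied near 0, where they
    are affine, and [h] can be rebuilt from its values near 0 because
    [h x = g^n (h (x / 2^n))].

    Near 0 the map [phi] is monotone, as [psi] is affine there.  If it is
    locally constant then [phi] is constant, hence so is [psi].  Otherwise
    [phi] fixes 0 ([tent_commuting_germ]), and it is linear near 0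
    ([tent_commuting_linear]): two points
    have the same image under the [n]-th iterate of the tent map exactly when
    [2^n] times their sum or difference is an even integer, so, as [x] varies,
    [phi (x + u) - phi x] with [u = 2 / 2^n] can leave [2 / 2^n] times the
    integers only where the increasing function [phi (x + u) + phi x] enters
    them, that is, countably often; by continuity the difference is constant.
    Thus [phi] is additive with respect to arbitrarily small steps [u], and a
    monotone function with that property is linear
    ([linear_of_small_periods]).  The slope is a natural number [m].  If [m] is
    a power [2^s], then [phi] agrees near 0, hence everywhere, with the [s]-th
    iterate of the tent map, and [psi] is an iterate of [g].

    So [m] is not a power of 2, and near 0 the conjugacy is homogeneous for two
    incommensurable factors: [h (2 x) = a h x] and [h (m x) = b h x].  The same
    then holds for all factors [l] in the group generated by 2 and [m], and this
    group has elements other than 1 arbitrarily near 1 ([quotients_near_1]).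
    Alone, these relations would still allow a power function.  The decreasing
    branch of the tent map excludes it: as [tent (1 - u) = tent u] and [g] is
    affine on the left of 1, the difference [1 - h (1 - u)] is proportional to
    [h u], and pulling this back along the increasing branch gives
    [h (y - u) = h y - c h u] at every [y = 1 / 2^n], for all small [u >= 0],
    with [c] depending on [y] ([conj_fold]).  If [y] is small enough, rescaling this by a
    factor [l < 1] near 1 gives the same relation, with the same [c], at [l y],
    and comparing the two yields [h (u + v) = h u + h v] for
    [u = (1 - l) y], which is as small as desired.  The linearity criterion
    applies once more: [h] is linear near 0 ([conj_linear_near_0]).  Finally
    [h x = g^n (h (x / 2^n))] makes [h] affine on both sides of every point,
    and by compactness of the unit interval [h] is piecewise linear. *)

Set Implicit Arguments.
Unset Strict Implicit.
Unset Printing Implicit Defensive.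

Import Order.TTheory GRing.Theory Num.Theory.

Local Open Scope classical_set_scope.
Local Open Scope ring_scope.

Arguments tent {R} x.

(** * Affine germs and piecewise linear maps *)

Lemma within_continuousP {R : realType} (f : R -> R) (a b : R) :
  {within `[a, b], continuous f} <->
  forall x, a <= x <= b -> forall e, 0 < e ->
    exists2 d, 0 < d & forall y, a <= y <= b -> `|x - y| < d -> `|f x - f y| < e.
Proof.
split=> [/subspace_continuousP cf x xab e e0|cf].
  have /cvgrPdist_lt/(_ _ e0) := cf x xab.
  move=> /nbhs_ballP[d /= d0 dP].
  by exists d => // y yab xyd; apply: dP.
apply/subspace_continuousP => x xab; apply/cvgrPdist_lt => e e0.
have [d d0 dP] := cf x xab e e0.
by apply/nbhs_ballP; exists d => // y /= xyd yab; exact: dP.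
Qed.

Lemma within_continuous_unit_comp {R : realType} (f1 f2 : R -> R) :
  (forall x, 0 <= x <= 1 -> 0 <= f1 x <= 1) ->
  {within `[0, 1], continuous f1} -> {within `[0, 1], continuous f2} ->
  {within `[0, 1], continuous (f2 \o f1)}.
Proof.
move=> u1 /within_continuousP c1 /within_continuousP c2.
apply/within_continuousP => x x01 e e0.
have [d d0 dP] := c2 _ (u1 _ x01) e e0.
have [r r0 rP] := c1 _ x01 d d0.
by exists r => // y y01 xy /=; apply: dP; [exact: u1|exact: rP].
Qed.

(** Affine germs along every ray that stays in the unit interval.  The
    direction [d] is an arbitrary real, not just a sign: the image under [f] of
    a short ray is then again such a ray, or a point when the slope is 0, and
    germs compose without case distinctions. *)
Definition locally_affine {R : realType} (f : R -> R) : Prop :=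
  forall z d : R, 0 <= z <= 1 -> 0 <= z + d <= 1 ->
  exists e s : R, 0 < e <= 1 /\ forall t, 0 <= t <= e -> f (z + d * t) = f z + s * t.

Lemma unit_segment {R : realType} (z d t : R) :
  0 <= z <= 1 -> 0 <= z + d <= 1 -> 0 <= t <= 1 -> 0 <= z + d * t <= 1.
Proof.
move=> /andP[z0 z1] /andP[zd0 zd1] /andP[t0 t1].
have -> : z + d * t = (1 - t) * z + t * (z + d) by ring.
have t1' : 0 <= 1 - t by lra.
apply/andP; split; first by rewrite addr_ge0// mulr_ge0.
have := ler_wpM2l t1' z1; have := ler_wpM2l t0 zd1; lra.
Qed.

(** A convex set either contains an initial piece of a given ray, its origin
    excluded, or misses such a piece; if all members of a finite family miss one,
    they miss a common one, and the family does not cover the ray. *)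
Lemma ray_initially_in_interval {R : realType} (s : seq (interval R)) (z d : R) :
  (forall t, 0 <= t <= 1 -> has (fun i : interval R => z + d * t \in i) s) ->
  exists i : interval R, i \in s /\
    exists2 e : R, 0 < e <= 1 & forall t, 0 < t < e -> z + d * t \in i.
Proof.
move=> cov.
have [//|[e e01 eP]] : (exists i : interval R, i \in s /\
      exists2 e : R, 0 < e <= 1 & forall t, 0 < t < e -> z + d * t \in i) \/
    (exists2 e : R, 0 < e <= 1 &
      forall t, 0 < t < e -> ~~ has (fun i : interval R => z + d * t \in i) s).
  elim: s {cov} => [|i s [[j [js jP]]|[e e01 eP]]].
  - by right; exists 1 => //; rewrite ltr01 lexx.
  - by left; exists j; rewrite inE js orbT.
  have [[e' e'01 e'P]|meets] :=
      pselect (exists2 e : R, 0 < e <= 1 & forall t, 0 < t < e -> z + d * t \notin i).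
    right; exists (Order.min e e'); first by rewrite minEle; case: ifP.
    move=> t /andP[t0]; rewrite lt_min => /andP[te te'] /=.
    by rewrite negb_or e'P ?t0// eP// t0.
  have {}meets e' : 0 < e' <= 1 -> exists2 t, 0 < t < e' & z + d * t \in i.
    move=> e'01; apply: contrapT => none; apply: meets; exists e' => // t te'.
    by apply/negP => ti; apply: none; exists t.
  left; exists i; rewrite inE eqxx; split=> //.
  have [|t0 t01 t0i] := meets 1; first by rewrite ltr01 lexx.
  exists t0; first lra.
  move=> t tt0; have [|t1 t1t t1i] := meets t; first lra.
  have cvx := @interval_is_interval R i.
  have [d0|d0] := lerP 0 d.
    apply: (cvx _ _ t1i t0i); rewrite !lerD2l !ler_wpM2l//; lra.
  apply: (cvx _ _ t0i t1i); rewrite !lerD2l !ler_wnM2l//; lra.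
have : 0 < e / 2 < e by lra.
by move=> /eP/negP; case; apply: cov; lra.
Qed.

Lemma piecewise_linear_locally_affine {R : realType} (f : R -> R) :
  piecewise_linear f -> locally_affine f.
Proof.
move=> [/within_continuousP cf [s [cov aff]]] z d z01 zd01.
have ray t : 0 <= t <= 1 -> 0 <= z + d * t <= 1 by exact: unit_segment.
have [t t01|i [/aff[a [b ab]] [e e01 eP]]] := @ray_initially_in_interval _ s z d.
  by rewrite -cov in_itv /= ray.
have fE t : 0 < t < e -> f (z + d * t) = a * z + b + a * d * t.
  by move=> te; rewrite ab ?eP//; ring.
(* The interval given by the covering may omit the origin z of the ray, so the
   value there has to come from continuity. *)
suff fz : f z = a * z + b.
  exists (e / 2), (a * d); split; first lra.
  move=> t /andP[]; rewrite le_eqVlt => /orP[/eqP<- _|t0 te].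
    by rewrite !mulr0 !addr0.
  by rewrite fE ?fz//; lra.
apply/eqP; rewrite -subr_eq0 -normr_eq0; apply: contraT => q_neq0.
set q := `|_| in q_neq0; have q0 : 0 < q by rewrite lt_def q_neq0 normr_ge0.
have q20 : 0 < q / 2 by rewrite divr_gt0.
have [r r0 rP] := cf z z01 _ q20.
have [n1 n2] : 0 <= `|d| /\ 0 <= `|a * d| by [].
pose t := Order.min e (Order.min (r / (`|d| + 1)) (q / 2 / (`|a * d| + 1))) / 2.
have t0 : 0 < t by rewrite divr_gt0// !lt_min !divr_gt0//; lra.
have : t < Order.min e (Order.min (r / (`|d| + 1)) (q / 2 / (`|a * d| + 1))).
  by rewrite /t ltr_pdivrMr// mulr_natr mulr2n ltrDl; rewrite /t in t0; lra.
have [p1 p2] : 0 < `|d| + 1 /\ 0 < `|a * d| + 1 by split; lra.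
rewrite !lt_min !ltr_pdivlMr// => /and3P[te tr tq].
have t01 : 0 <= t <= 1 by lra.
have := rP _ (ray t t01); rewrite opprD addNKr normrN normrM (ger0_norm (ltW t0)).
move=> /(_ ltac:(lra)); rewrite fE; last lra.
have : `|a * d * t| < q / 2 by rewrite normrM (ger0_norm (ltW t0)); lra.
move=> B1 B2; have := ltrD B1 B2; rewrite -splitr.
move=> /(le_lt_trans (ler_normD _ _)); rewrite [X in `|X|](_ : _ = f z - (a * z + b)).
  by rewrite ltxx.
by ring.
Qed.

Lemma locally_affine_comp {R : realType} (f g : R -> R) :
  (forall x, 0 <= x <= 1 -> 0 <= f x <= 1) ->
  locally_affine f -> locally_affine g -> locally_affine (g \o f).
Proof.
move=> f01 laf lag z d z01 zd01.
have [e [s [/andP[e0 e1] fE]]] := laf z d z01 zd01.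
have ze : 0 <= z + d * e <= 1 by apply: unit_segment; lra.
have fze : 0 <= f z + s * e <= 1 by rewrite -fE ?lexx ?(ltW e0)// f01.
have [e' [s' [/andP[e'0 e'1] gE]]] := lag (f z) (s * e) (f01 _ z01) fze.
exists (e * e'), (s' / e); split; first by rewrite mulr_gt0//= mulr_ile1// ltW.
move=> t /andP[t0 te]; rewrite /= fE; last first.
  by rewrite t0 (le_trans te)// ler_piMr// ltW.
have -> : s * t = s * e * (t / e) by field; rewrite gt_eqF.
rewrite gE ?divr_ge0 ?(ltW e0)//= ?ler_pdivrMr// 1?mulrC//.
by congr +%R; field; rewrite gt_eqF.
Qed.

(** Let [m] be the supremum of the [x] such that [f] is piecewise linear on
    [[0, x]].  The left germ at [m] shows that [m] is such an [x], and the right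
    germ would push beyond [m] if [m < 1]. *)
Lemma locally_affine_piecewise_linear {R : realType} (f : R -> R) :
  {within `[0, 1], continuous f} -> locally_affine f -> piecewise_linear f.
Proof.
move=> cf laf; split=> //.
pose PL x (s : seq (interval R)) :=
  (forall y, (0 <= y <= x) = has (fun i : interval R => y \in i) s) /\
  (forall i : interval R, i \in s -> exists a b : R, {in i, forall y, f y = a * y + b}).
pose E x := 0 <= x <= 1 /\ exists s, PL x s.
have extend x y : E x -> x <= y -> y <= 1 ->
    (exists a b, forall w, x <= w <= y -> f w = a * w + b) -> E y.
  move=> [/andP[x0 x1] [s [cov aff]]] xy y1 [a [b ab]]; split; first lra.
  exists (`[x, y] :: s); split=> [w|i].
    by rewrite /= in_itv /= -cov; apply/idP/idP; lra.
  rewrite inE => /orP[/eqP->|]; last exact: aff.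
  by exists a, b => w; rewrite in_itv /=; apply: ab.
have E0 : E 0.
  split; first by rewrite lexx ler01.
  exists [:: `[0, 0]]; split=> [w|i]; first by rewrite /= in_itv /= orbF.
  rewrite inE => /eqP->; exists 0, (f 0) => w; rewrite in_itv /= => w0.
  by rewrite mul0r add0r; congr f; lra.
have supE : has_sup E by split; [exists 0|exists 1 => x [/andP[]]].
set m := sup E.
have Em x : E x -> x <= m by move=> Ex; apply: (ub_le_sup supE.2).
have m01 : 0 <= m <= 1.
  by rewrite Em//=; apply: ge_sup; [exists 0|move=> x [/andP[]]].
have {}Em_mem : E m.
  have /andP[m0 m1] := m01; move: m0; rewrite le_eqVlt => /orP[/eqP<-//|m0].
  have [|e [s [/andP[e0 e1] fE]]] := laf m (- m) m01; first by rewrite subrr lexx ler01.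
  have me0 : 0 < m * e by rewrite mulr_gt0.
  have [x Ex xm] := sup_adherent me0 supE; rewrite -/m in xm.
  apply: (extend x) => //; first exact: Em.
  exists (- (s / m)), (f m + s) => w /andP[xw wm].
  have -> : w = m + - m * ((m - w) / m) by field; rewrite gt_eqF.
  rewrite fE; first by field; rewrite gt_eqF.
  rewrite divr_ge0 ?subr_ge0 ?(ltW m0)//= ler_pdivrMr//; lra.
suff m1 : m = 1.
  have [_ [s [cov aff]]] := Em_mem; exists s; split=> // x.
  by rewrite in_itv /= -cov m1.
have /andP[m0] := m01; rewrite le_eqVlt => /orP[/eqP//|m1].
have [|e [s [/andP[e0 e1] fE]]] := laf m (1 - m) m01.
  by rewrite addrC subrK lexx ler01.
have d0 : 0 < 1 - m by lra.
have de0 : 0 < (1 - m) * e by rewrite mulr_gt0.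
have de1 : (1 - m) * e <= (1 - m) by rewrite ler_piMr// ltW.
suff Ey : E (m + (1 - m) * e) by have := Em _ Ey; lra.
apply: (extend m) => //; try lra.
exists (s / (1 - m)), (f m - s / (1 - m) * m) => w /andP[mw we].
have -> : w = m + (1 - m) * ((w - m) / (1 - m)) by field; rewrite gt_eqF.
rewrite fE; first by field; rewrite gt_eqF.
have t0 : 0 <= (w - m) / (1 - m) by apply: divr_ge0; lra.
rewrite t0 /= ler_pdivrMr//; lra.
Qed.

(** * Linearity from small periods, and quotients of powers *)

Lemma archimedean_pow2 {R : realType} (e : R) : 0 < e -> exists n, 1 < e * 2 ^+ n.
Proof.
move=> e0; pose n := (Num.truncn e^-1).+1; exists n.
have nP : e^-1 < n%:R by apply: truncnS_gt.
rewrite -ltr_pdivrMl // mulr1 (lt_trans nP)//.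
by rewrite -natrX ltr_nat ltn_expl.
Qed.

(** For [u] small, every [x] is [n * u + v] with [0 <= v <= u], and [F x] is
    [n * F u + F v] with [0 <= F v <= F u]; writing [Y] in the same way, the two
    sides of the conclusion differ by at most [3 * F Y * u]. *)
Lemma linear_of_small_periods {R : realType} (F : R -> R) (Y : R) : 0 < Y ->
  (forall x y, 0 <= x -> x <= y -> y <= Y -> F x <= F y) ->
  (forall e, 0 < e -> exists2 u, 0 < u < e &
     forall v, 0 <= v -> u + v <= Y -> F (u + v) = F u + F v) ->
  forall x, 0 <= x <= Y -> F x * Y = F Y * x.
Proof.
move=> Y0 mF perF x /andP[x0 xY].
have F0 : F 0 = 0.
  have [u uY uP] := perF Y Y0.
  have : F (u + 0) = F u + F 0 by apply: uP; lra.
  rewrite addr0; lra.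
apply/eqP; rewrite -subr_eq0 -normr_eq0; apply: contraT => dn0.
set d := `|_| in dn0; have d0 : 0 < d by rewrite lt_def dn0 normr_ge0.
have FY0 : 0 <= F Y by rewrite -F0; apply: mF; lra.
have e0 : 0 < Order.min Y (d / (3 * F Y + 1)).
  by rewrite lt_min Y0 divr_gt0//; lra.
have [u + perF'] := perF _ e0; rewrite lt_min ltr_pdivlMr => [/andP[u0]/andP[uY ud]|]; last lra.
have Fn n v : 0 <= v -> n%:R * u + v <= Y -> F (n%:R * u + v) = n%:R * F u + F v.
  move=> v0; elim: n => [|n IH]; first by rewrite !mul0r !add0r.
  have -> : n.+1%:R * u + v = u + (n%:R * u + v) by ring.
  have n0 : 0 <= n%:R * u :> R by rewrite mulr_ge0// ltW.
  move=> nY; rewrite perF' //; first by rewrite IH; [ring|lra].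
  lra.
have dec z : 0 <= z -> z <= Y ->
    exists n, exists2 v, 0 <= v <= u & z = n%:R * u + v /\ F z = n%:R * F u + F v.
  move=> z0 zY; have := @truncn_itv R (z / u); rewrite divr_ge0//; last lra.
  move=> /(_ isT); rewrite ler_pdivlMr// ltr_pdivrMr//; set n := Num.truncn _.
  rewrite -natr1 mulrDl => /andP[nz zn].
  exists n, (z - n%:R * u); first lra.
  split; first by rewrite addrC subrK.
  rewrite -Fn; [congr F; lra|lra|lra].
have [n [v /andP[v0 vu] [xE FxE]]] := dec x x0 xY.
have [N [w /andP[w0 wu] [YE FYE]]] := dec Y (ltW Y0) (lexx _).
have Fv0 : 0 <= F v by rewrite -F0; apply: mF; lra.
have Fw0 : 0 <= F w by rewrite -F0; apply: mF; lra.
have Fvu : F v <= F u by apply: mF; lra.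
have Fwu : F w <= F u by apply: mF; lra.
have FuY : F u <= F Y by apply: mF; lra.
have FxY : F x <= F Y by apply: mF; lra.
have nFu : n%:R * F u <= F Y by lra.
have NFu : N%:R * F u <= F Y by lra.
have bnd a p : 0 <= a -> a <= F Y -> 0 <= p -> p <= u -> 0 <= a * p <= F Y * u.
  by move=> a0 aF p0 pu; rewrite mulr_ge0//= ler_pM.
have Nn k : 0 <= k%:R * F u by rewrite mulr_ge0//; lra.
have B1 := bnd _ _ (Nn n) nFu w0 wu.
have B2 := bnd _ _ (Nn N) NFu v0 vu.
have B3 := bnd (F v) w Fv0 ltac:(lra) w0 wu.
have B4 := bnd (F w) v Fw0 ltac:(lra) v0 vu.
have Nu k t : 0 <= t -> t <= F u -> 0 <= k%:R * t <= k%:R * F u.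
  by move=> t0 tu; rewrite mulr_ge0//= ler_wpM2l.
have M1 := Nu n _ Fw0 Fwu.
have M2 := Nu N _ Fv0 Fvu.
have B5 := bnd (n%:R * F w) u ltac:(lra) ltac:(lra) (ltW u0) (lexx _).
have B6 := bnd (N%:R * F v) u ltac:(lra) ltac:(lra) (ltW u0) (lexx _).
have : d <= 3 * F Y * u.
  rewrite /d ler_norml FxE FYE xE YE -FYE.
  have -> : (n%:R * F u + F v) * (N%:R * u + w) - F Y * (n%:R * u + v) =
    n%:R * F u * w + N%:R * F v * u + F v * w - (N%:R * F u * v + n%:R * F w * u + F w * v).
    by rewrite FYE; ring.
  lra.
lra.
Qed.

(** The powers of [m], divided by the powers of 2 that bring them into [[1, 2[],
    are pairwise distinct because [m] is not a power of 2, so by the pigeonhole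
    principle two of them are at distance less than [e]; their quotient is
    the factor sought. *)
Lemma quotients_near_1 {R : realType} (P : R -> Prop) (m : nat) :
  (0 < m)%N -> (forall s, m <> (2 ^ s)%N) -> P 2 -> P m%:R ->
  (forall x y, 0 < x -> 0 < y -> P x -> P y -> P (x / y)) ->
  forall e, 0 < e -> exists2 l, 1 - e < l < 1 & P l.
Proof.
move=> m0 mN2 P2 Pm PV e e0.
have P1 : P 1 by rewrite -(@divff R 2) //; apply: (PV).
have PM x y : 0 < x -> 0 < y -> P x -> P y -> P (x * y).
  move=> x0 y0 Px Py; rewrite -[y]invrK; apply: (PV); rewrite ?invr_gt0//.
  by rewrite -div1r; apply: (PV).
have PX x n : 0 < x -> P x -> P (x ^+ n).
  by move=> x0 Px; elim: n => // n IH; rewrite exprS; apply: (PM); rewrite ?exprn_gt0.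
pose E j := trunc_log 2 (m ^ j).
pose r j : R := m%:R ^+ j / 2 ^+ E j.
have m0R : 0 < m%:R :> R by rewrite ltr0n.
have r1 j : 1 <= r j < 2.
  rewrite /r ler_pdivlMr ?exprn_gt0// ltr_pdivrMr ?exprn_gt0// mul1r -exprS.
  rewrite -!natrX ler_nat ltr_nat.
  by apply: trunc_log_bounds => //; rewrite expn_gt0 m0.
have Pr j : P (r j) by apply: (PV); rewrite ?exprn_gt0//; apply: PX.
have r_inj j j' : (j < j')%N -> r j <> r j'.
  move=> jj' /eqP; rewrite /r eqr_div ?expf_neq0 ?pnatr_eq0// -!natrX -!natrM eqr_nat.
  rewrite -(subnKC jj') addSnnS expnD -mulnA eqn_pmul2l ?expn_gt0 ?m0// => /eqP H.
  have /(dvdn_pfactor _ _ (isT : prime 2))[s _ sE] : (m %| 2 ^ E (j + (j' - j.+1).+1))%N.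
    by rewrite H expnS -mulnA dvdn_mulr.
  exact: (mN2 s).
pose M' := Num.truncn e^-1; pose M : R := M'.+1%:R.
have M0 : 0 < M by rewrite ltr0n.
have eM : e^-1 < M by apply: truncnS_gt.
pose f (j : 'I_M'.+2) : 'I_M'.+1 := inord (Num.truncn ((r j - 1) * M)).
have : ~~ injectiveb f.
  by apply/injectiveP => /leq_card; rewrite !card_ord ltnn.
move=> /injectivePn[j [j' jj' fE]].
have itv k : let n := Num.truncn ((r k - 1) * M) in
    [/\ (n < M'.+1)%N, n%:R <= (r k - 1) * M & (r k - 1) * M < n%:R + 1].
  move=> n; have /andP[rk1 rk2] := r1 k.
  have := @truncn_itv R ((r k - 1) * M); rewrite mulr_ge0 ?(ltW M0)// ?subr_ge0//.
  move=> /(_ isT) /andP[n1 n2]; split=> //; last by rewrite natr1.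
  rewrite -(@ltr_nat R) (le_lt_trans n1)// -/M -[X in _ < X]mul1r ltr_pM2r//; lra.
have close : `|r j - r j'| < e.
  have [lj aj bj] := itv j; have [lj' aj' bj'] := itv j'.
  have /(congr1 val) := fE; rewrite /= !inordK// => nE.
  rewrite -[e]invrK -[X in _ < X]mul1r ltr_pdivlMr ?invr_gt0//.
  apply: le_lt_trans (_ : `|r j - r j'| * M < 1); first by rewrite ler_wpM2l// ltW.
  rewrite -[M]gtr0_norm// -normrM ltr_norml; rewrite nE in aj bj.
  lra.
have main k k' : r k < r k' -> `|r k - r k'| < e -> exists2 l, 1 - e < l < 1 & P l.
  move=> kk'; rewrite ltr0_norm ?subr_lt0// => kke.
  have /andP[rk _] := r1 k; have /andP[rk' _] := r1 k'.
  exists (r k / r k'); last by apply: (PV) => //; lra.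
  have rk'0 : 0 < r k' by lra.
  rewrite ltr_pdivlMr // ltr_pdivrMr //.
  
  suff : e <= e * r k' by lra.
  by rewrite ler_peMr// ltW.
have [lt|lt|] := ltgtP (r j) (r j').
- exact: main close.
- by apply: main lt _; rewrite distrC.
- move: jj'; rewrite neq_ltn => /orP[]/r_inj; last by move/eqP; rewrite eq_sym => /eqP.
  by [].
Qed.

(** * Maps commuting with the tent map *)

Lemma tentL {R : realType} (x : R) : x <= 1 / 2 -> tent x = 2 * x.
Proof. by move=> xh; rewrite /tent ger0_norm; lra. Qed.

Lemma tentR {R : realType} (x : R) : 1 / 2 <= x -> tent x = 2 - 2 * x.
Proof. by move=> xh; rewrite /tent ler0_norm; lra. Qed.

Lemma tent_unit {R : realType} (x : R) : 0 <= x <= 1 -> 0 <= tent x <= 1.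
Proof.
by move=> x01; have [c|/ltW c] := lerP x (1 / 2); [rewrite tentL//|rewrite tentR//]; lra.
Qed.

Lemma divr_pow2_unit {R : realType} n (x : R) : 0 <= x <= 1 -> 0 <= x / 2 ^+ n <= 1.
Proof.
move=> /andP[x0 x1]; rewrite divr_ge0 ?exprn_ge0//= ler_pdivrMr ?exprn_gt0// mul1r.
by rewrite (le_trans x1)// exprn_ege1// ler1n.
Qed.

Lemma iter_tent_pow2 {R : realType} n (x : R) : 0 <= x <= 1 ->
  iter n tent (x / 2 ^+ n) = x.
Proof.
move=> x01; elim: n => [|n IH]; first by rewrite divr1.
have xn := divr_pow2_unit n x01.
have E : x / 2 ^+ n.+1 = x / 2 ^+ n / 2 by rewrite exprSr invfM mulrA.
rewrite iterSr E tentL; last lra.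
by rewrite mulrC divfK// IH.
Qed.

Lemma iter_stable {T : Type} (P : T -> Prop) (f : T -> T) n x :
  (forall x, P x -> P (f x)) -> P x -> P (iter n f x).
Proof. by move=> Pf Px; elim: n => //= n; apply: Pf. Qed.

Lemma iter_commute {T : Type} (P : T -> Prop) (f phi : T -> T) n x :
  (forall x, P x -> P (f x)) -> (forall x, P x -> phi (f x) = f (phi x)) ->
  P x -> phi (iter n f x) = iter n f (phi x).
Proof.
move=> Pf Pphi Px; elim: n => //= n IH.
by rewrite Pphi ?IH//; apply: iter_stable.
Qed.

(** Equality of [A] and [B] after folding the real line onto [[0, 1]] by the
    reflections in the integers. *)
Definition same_fold {R : realType} (A B : R) : Prop :=
  exists j : int, A - B = 2 * j%:~R \/ A + B = 2 * j%:~R.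

Lemma same_fold_sym {R : realType} (A B : R) : same_fold A B -> same_fold B A.
Proof.
case=> j [E|E]; [exists (- j); left; rewrite mulrNz; lra|exists j; right; lra].
Qed.

Lemma same_fold_reflect {R : realType} (a : int) (A B : R) :
  same_fold A B -> same_fold (2 * a%:~R - A) B.
Proof.
case=> j [E|E]; exists (a - j); rewrite intrB; [right|left]; lra.
Qed.

Lemma same_fold_tent {R : realType} n (x B : R) :
  same_fold (2 ^+ n * tent x) B <-> same_fold (2 ^+ n.+1 * x) B.
Proof.
have [/tentL|/ltW/tentR] := lerP x (1 / 2) => ->; rewrite exprSr.
  by rewrite mulrA.
have -> : 2 ^+ n * (2 - 2 * x) = 2 * (2 ^+ n)%:~R - 2 ^+ n * 2 * x :> R.
  by rewrite rmorphXn /=; ring.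
split=> [/(same_fold_reflect (2 ^+ n))|]; last exact: same_fold_reflect.
by rewrite opprB addrC subrK.
Qed.

Lemma iter_tent_eqP {R : realType} n (x y : R) : 0 <= x <= 1 -> 0 <= y <= 1 ->
  iter n tent x = iter n tent y <-> same_fold (2 ^+ n * x) (2 ^+ n * y).
Proof.
elim: n x y => [|n IH] x y x01 y01.
  rewrite !mul1r /=; split=> [->|]; first by exists 0; left; rewrite subrr mulr0.
  case=> j [E|E].
    have /andP[j1 j2] : -1 < j < 1 by rewrite -!(@ltr_int R); lra.
    have j0 : j = 0 by lia.
    by rewrite j0 in E; lra.
  have /andP[j1 j2] : -1 < j < 2 by rewrite -!(@ltr_int R); lra.
  have [j0|j0] : j = 0 \/ j = 1 by lia.
    by rewrite j0 in E; lra.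
  by rewrite j0 in E; lra.
rewrite !iterSr (IH _ _ (tent_unit x01) (tent_unit y01)) same_fold_tent.
by split=> /same_fold_sym/same_fold_tent/same_fold_sym.
Qed.

Lemma interval_uncountable {R : realType} (a b : R) : a < b -> ~ countable `[a, b].
Proof.
move=> ab /countable_lebesgue_measure0; rewrite lebesgue_measure_itv /= lte_fin ab.
by rewrite -EFinD => -[]; lra.
Qed.

(** A non-constant [D] takes every value of some interval.  Such a value is
    determined by an integer: either it is one, or it is taken at a point where
    [S] is an integer, which determines the point.  So the interval would be
    countable. *)
Lemma const_of_integer_values {R : realType} (D S : R -> R) (a b : R) :
  {within `[a, b], continuous D} ->
  (forall x y, a <= x <= b -> a <= y <= b -> S x = S y -> x = y) ->
  (forall x, a <= x <= b -> exists j : int, D x = j%:~R \/ S x = j%:~R) ->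
  forall x, a <= x <= b -> D x = D a.
Proof.
move=> cD Sinj DS x /andP[ax xb]; apply/eqP/negPn/negP => Dxa.
set lo := Order.min (D a) (D x); set hi := Order.max (D a) (D x).
have lohi : lo < hi.
  by move: Dxa; rewrite /lo /hi neq_lt; case: ltgtP.
apply: (interval_uncountable lohi).
have code d : exists c : bool * int, lo <= d <= hi -> exists z,
    [/\ a <= z <= b, D z = d & (if c.1 then D z else S z) = c.2%:~R].
  have [dlh|] := boolP (lo <= d <= hi); last by exists (true, 0).
  have [|z zab Dz] := @IVT R D a x d ax _ dlh.
    apply: continuous_subspaceW cD => t /=; rewrite !in_itv /=; lra.
  have zab' : a <= z <= b by move: zab; rewrite in_itv /=; lra.
  by have [j [E|E]] := DS z zab'; [exists (true, j)|exists (false, j)] => _; exists z.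
(* The boolean tells which of D and S is an integer at the chosen preimage. *)
have [c cP] := choice code.
apply/countable_injP; exists (pickle \o c) => d d'.
rewrite !inE /= !in_itv /= => /cP[z [zab Dz cz]] /cP[z' [zab' Dz' cz']].
move=> /(pcan_inj pickleK) cE; rewrite -Dz -Dz'.
move: cz cz'; rewrite cE; case: (c d').1 => [->->//|E E'].
by rewrite (Sinj z z')// E E'.
Qed.

Definition commutes_with_tent {R : realType} (phi : R -> R) : Prop :=
  (forall x, 0 <= x <= 1 -> 0 <= phi x <= 1) /\
  (forall x, 0 <= x <= 1 -> phi (tent x) = tent (phi x)).

(** Every point of the unit interval is the image under [tent^n] of a point as
    near to 0 as desired, so a map commuting with the tent map is determined by
    its germ at 0. *)
Lemma tent_commuting_eq {R : realType} (phi1 phi2 : R -> R) (d : R) : 0 < d ->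
  commutes_with_tent phi1 -> commutes_with_tent phi2 ->
  (forall x, 0 <= x <= d -> phi1 x = phi2 x) ->
  forall x, 0 <= x <= 1 -> phi1 x = phi2 x.
Proof.
move=> d0 [_ c1] [_ c2] E x x01; have [n dn] := archimedean_pow2 d0.
have xn := divr_pow2_unit n x01.
rewrite -(iter_tent_pow2 n x01) !(iter_commute (P := fun x => 0 <= x <= 1))//;
  try exact: tent_unit.
congr iter; apply: E; rewrite (andP xn).1 /= ler_pdivrMr ?exprn_gt0//; lra.
Qed.

(** Points at distance [u = 2 / 2 ^ n] have the same image under [tent^n], so at
    every [x] either the difference or the sum of [phi (x + u)] and [phi x] lies
    in [2 / 2 ^ n] times the integers.  The sum is injective in [x], so the
    difference is constant, that is, [phi (x + u) = phi x + phi u]. *)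
Lemma tent_commuting_linear {R : realType} (phi : R -> R) (d : R) : 0 < d <= 1 ->
  commutes_with_tent phi -> {within `[0, 1], continuous phi} -> phi 0 = 0 ->
  (forall x y, 0 <= x -> x < y -> y <= d -> phi x < phi y) ->
  exists2 m : nat, (0 < m)%N & forall x, 0 <= x <= d -> phi x = m%:R * x.
Proof.
move=> /andP[d0 d1] [phi01 phic] cphi phi0 phi_inc.
have fold n x y : 0 <= x <= 1 -> 0 <= y <= 1 ->
    same_fold (2 ^+ n * x) (2 ^+ n * y) ->
    same_fold (2 ^+ n * phi x) (2 ^+ n * phi y).
  move=> x01 y01 /iter_tent_eqP E.
  apply/iter_tent_eqP; try exact: phi01.
  rewrite -!(iter_commute (P := fun x => 0 <= x <= 1) (f := tent) (phi := phi))//;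
    try exact: tent_unit.
  by congr phi; apply: E.
have phi_le x y : 0 <= x -> x <= y -> y <= d -> phi x <= phi y.
  by rewrite [x <= y]le_eqVlt => x0 /orP[/eqP->//|xy] yd; apply/ltW/phi_inc.
have lin x : 0 <= x <= d -> phi x * d = phi d * x.
  apply: linear_of_small_periods => // e e0.
  have e'0 : 0 < Order.min e d / 2 by rewrite divr_gt0// lt_min e0 d0.
  have [n nP] := archimedean_pow2 e'0.
  have N0 : 0 < 2 ^+ n :> R by rewrite exprn_gt0.
  have [ue ud] : 2 / 2 ^+ n < e /\ 2 / 2 ^+ n < d.
    by split; rewrite ltr_pdivrMr//; move: nP; rewrite minEle; case: ifP; nra.
  set u := 2 / 2 ^+ n in ue ud.
  have u0 : 0 < u by rewrite divr_gt0.
  exists u; first by rewrite u0 ue.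
  move=> v v0 uvd.
  pose D t := 2 ^+ n * (phi (t + u) - phi t) / 2.
  pose S t := 2 ^+ n * (phi (t + u) + phi t) / 2.
  suff : D v = D 0.
    rewrite /D add0r phi0 subr0 => /(congr1 (fun z => z * 2)).
    rewrite !divfK ?pnatr_eq0//.
    by move=> /(mulfI (lt0r_neq0 N0)); rewrite [v + u]addrC; lra.
  apply: (@const_of_integer_values _ D S 0 (d - u)); last lra.
  - apply/within_continuousP => t t01 r r0.
    have r'0 : 0 < r / 2 ^+ n by rewrite divr_gt0.
    have [d1' d1'0 P1] := (within_continuousP phi 0 1).1 cphi t ltac:(lra) _ r'0.
    have [d2' d2'0 P2] := (within_continuousP phi 0 1).1 cphi (t + u) ltac:(lra) _ r'0.
    exists (Order.min d1' d2'); first by rewrite lt_min d1'0.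
    move=> y y01; rewrite lt_min => /andP[yd1 yd2].
    have := P1 y ltac:(lra) yd1.
    have := P2 (y + u) ltac:(lra); rewrite opprD addrACA subrr addr0 => /(_ yd2).
    move=> B2 B1.
    have -> : D t - D y = ((phi (t + u) - phi (y + u)) - (phi t - phi y)) / 2 * 2 ^+ n.
      by rewrite /D; ring.
    rewrite normrM (gtr0_norm N0) -ltr_pdivlMr//.
    move: B1 B2; rewrite !ltr_norml; lra.
  - have S_inc x1 x2 : 0 <= x1 -> x1 < x2 -> x2 <= d - u -> S x1 < S x2.
      move=> x10 x12 x2d; rewrite /S ltr_pM2r ?invr_gt0// ltr_pM2l//.
      by apply: ltrD; apply: phi_inc; lra.
    move=> x1 x2 x1d x2d SE; have [lt|lt|//] := ltgtP x1 x2.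
      by have := S_inc _ _ _ lt _; rewrite SE ltxx; lra.
    by have := S_inc _ _ _ lt _; rewrite SE ltxx; lra.
  - move=> t td.
    have [|||j jP] := fold n (t + u) t; try lra.
      exists 1; left; rewrite mulrDr /u; field; lra.
    exists j; case: jP => E; [left; rewrite /D|right; rewrite /S]; lra.
have N0 n : 0 < 2 ^+ n :> R by rewrite exprn_gt0.
have [n nP] : exists n, 1 < d / 2 * 2 ^+ n by apply: archimedean_pow2; lra.
have ud : 0 <= (2 : R) / 2 ^+ n <= d.
  by apply/andP; split; [apply/divr_ge0/ltW|rewrite ler_pdivrMr//; lra].
(* The slope is an integer because 2 / 2 ^ n and 0 have the same image under
   tent^n, so that 2 ^ n * phi (2 / 2 ^ n) is an even integer. *)
have [j jP] : exists j : int, phi d / d = j%:~R.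
  have [|||j jP] := fold n (2 / 2 ^+ n) 0; try lra.
    by exists 1; left; field; rewrite gt_eqF.
  exists j; move: jP; rewrite phi0 mulr0 addr0 subr0 => jP.
  have {}jP : 2 ^+ n * phi (2 / 2 ^+ n) = 2 * j%:~R by case: jP.
  apply: (canLR (mulfK (lt0r_neq0 d0))).
  have -> : phi d = phi d * (2 / 2 ^+ n) * 2 ^+ n / 2 by field; rewrite gt_eqF.
  rewrite -lin //.
  have -> : phi (2 / 2 ^+ n) * d * 2 ^+ n = 2 ^+ n * phi (2 / 2 ^+ n) * d by ring.
  by rewrite jP; field.
have phid : 0 < phi d by rewrite -phi0; apply: phi_inc.
have j0 : 0 < j by rewrite -(@ltr_int R) -jP divr_gt0.
exists `|j|%N; first by rewrite absz_gt0 gt_eqF.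
move=> x /lin E; rewrite natr_absz gtr0_norm// -jP.
by rewrite mulrAC -E mulfK// gt_eqF.
Qed.

(** * Conjugacies between the tent map and a piecewise linear map *)

Record increasing_conjugacy {R : realType} (g h : R -> R) : Prop := IncreasingConjugacy {
  conj_unit : forall x, 0 <= x <= 1 -> 0 <= h x <= 1;
  conj_cont : {within `[0, 1], continuous h};
  conj_0 : h 0 = 0;
  conj_lt : forall x y, 0 <= x -> x < y -> y <= 1 -> h x < h y;
  conj_tent : forall x, 0 <= x <= 1 -> h (tent x) = g (h x) }.

(** An injective continuous map of an interval is monotone.  A decreasing [h]
    would send the fixed point 0 of the tent map to 1, which [g] does not fix. *)
Lemma conjugates_tent_increasing {R : realType} (g h : R -> R) :
  unimodal g -> conjugates_tent h g -> increasing_conjugacy g h.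
Proof.
move=> [_ [v [_ _ _ [_ g1] _]]] [[[h01 ch] [k [[k01 _] hk kh]]] hg].
have unit0 : (0 : R) \in `[0, 1] by rewrite in_itv /= lexx ler01.
have unit1 : (1 : R) \in `[0, 1] by rewrite in_itv /= lexx ler01.
have h_unit x : 0 <= x <= 1 -> 0 <= h x <= 1.
  by move=> x01; have := h01 x; rewrite /= !in_itv /=; apply.
have k_unit x : 0 <= x <= 1 -> 0 <= k x <= 1.
  by move=> x01; have := k01 x; rewrite /= !in_itv /=; apply.
have g00 : g (h 0) = h 0.
  by rewrite -hg//; congr h; rewrite tentL; lra.
have [mono|mono] := itv_continuous_inj_mono ch (can_in_inj hk).
- have h_lt x y : 0 <= x -> x < y -> y <= 1 -> h x < h y.
    by move=> x0 xy y1; apply: mono => //; rewrite in_itv /=; lra.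
  have h0 : h 0 = 0.
    have k0 := k_unit 0 ltac:(lra).
    have E := kh 0 unit0; have /andP[] := k0; rewrite le_eqVlt => /orP[/eqP k00|k0p] k01'.
      by rewrite {1}k00.
    have := h_lt 0 (k 0) (lexx _) k0p k01'; rewrite E.
    by have := h_unit 0 ltac:(lra); lra.
  by split.
exfalso; have h0 : h 0 = 1.
  have k1 := k_unit 1 ltac:(lra).
  have E := kh 1 unit1; have /andP[] := k1; rewrite le_eqVlt => /orP[/eqP k10|k1p] k11.
    by rewrite {1}k10.
  have := mono (k 1) 0 _ _ k1p; rewrite E !in_itv /= k1 lexx ler01 => /(_ isT isT).
  by have := h_unit 0 ltac:(lra); lra.
by move: g00; rewrite h0 g1; lra.
Qed.

Lemma conj_gt0 {R : realType} (g h : R -> R) (x : R) :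
  increasing_conjugacy g h -> 0 < x <= 1 -> 0 < h x.
Proof. by move=> ch /andP[x0 x1]; rewrite -(conj_0 ch); apply: (conj_lt ch). Qed.

Lemma conj_le {R : realType} (g h : R -> R) (x y : R) :
  increasing_conjugacy g h -> 0 <= x -> x <= y -> y <= 1 -> h x <= h y.
Proof.
move=> ch x0; rewrite le_eqVlt => /orP[/eqP->//|xy] y1.
exact/ltW/(conj_lt ch).
Qed.

Lemma conj_small {R : realType} (g h : R -> R) (e : R) :
  increasing_conjugacy g h -> 0 < e ->
  exists2 d, 0 < d <= 1 & forall x, 0 <= x <= d -> 0 <= h x <= e.
Proof.
move=> ch e0.
have [d d0 dP] := (within_continuousP h 0 1).1 (conj_cont ch) 0 ltac:(lra) e e0.
exists (Order.min 1 (d / 2)); first by rewrite lt_min ltr01 divr_gt0//= ge_min lexx.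
move=> x /andP[x0]; rewrite le_min => /andP[x1 xd].
have := dP x ltac:(lra); rewrite (conj_0 ch) !sub0r !normrN !ger0_norm//; last first.
  by rewrite -(conj_0 ch); apply: (conj_le ch).
have : 0 <= h x by rewrite -(conj_0 ch); apply: (conj_le ch).
by move=> hx0 /(_ ltac:(lra)); lra.
Qed.

Lemma conj_germ {R : realType} (g h psi : R -> R) :
  increasing_conjugacy g h -> locally_affine psi ->
  exists b d, 0 < d <= 1 /\ forall x, 0 <= x <= d -> psi (h x) = psi 0 + b * h x.
Proof.
move=> ch la; have [|e [b [/andP[e0 e1] E]]] := la 0 1 ltac:(lra); first lra.
have [d d01 dP] := conj_small ch e0.
exists b, d; split=> // x /dP hx.
by rewrite -E// add0r mul1r.
Qed.

Lemma conj_doubling {R : realType} (g h : R -> R) :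
  increasing_conjugacy g h -> locally_affine g ->
  exists a d, [/\ 0 < a, 0 < d <= 1 / 2 & forall x, 0 <= x <= d -> h (2 * x) = a * h x].
Proof.
move=> ch la; have [a [d [/andP[d0 d1] E]]] := conj_germ ch la.
have g0 : g 0 = 0.
  have t0 : tent 0 = 0 :> R by rewrite tentL; lra.
  by have := conj_tent ch (x := 0); rewrite t0 (conj_0 ch) lexx ler01 => <-.
have {}E x : 0 <= x <= d / 2 -> h (2 * x) = a * h x.
  move=> xd; rewrite -tentL; last lra.
  by rewrite (conj_tent ch) ?E ?g0 ?add0r//; lra.
exists a, (d / 2); split=> //; last lra.
have h1 : 0 < h (2 * (d / 2)) by apply: (conj_gt0 ch); lra.
have h2 : 0 < h (d / 2) by apply: (conj_gt0 ch); lra.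
by move: h1; rewrite E ?pmulr_lgt0//; lra.
Qed.

Definition scaled_by {R : realType} (h : R -> R) (l : R) : Prop :=
  exists c d, [/\ c != 0, 0 < d & forall x, 0 <= x <= d -> h (l * x) = c * h x].

Lemma scaled_by_div {R : realType} (h : R -> R) (x y : R) : 0 < x -> 0 < y ->
  scaled_by h x -> scaled_by h y -> scaled_by h (x / y).
Proof.
move=> x0 y0 [c1 [d1 [c10 d10 E1]]] [c2 [d2 [c20 d20 E2]]].
exists (c1 / c2), (Order.min d1 d2 * y); split.
- by rewrite mulf_neq0 ?invr_neq0.
- by rewrite mulr_gt0// lt_min d10.
move=> z /andP[z0]; rewrite -ler_pdivrMr// le_min => /andP[z1 z2].
have zy : 0 <= z / y by rewrite divr_ge0// ltW.
have -> : x / y * z = x * (z / y) by ring.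
rewrite E1 ?zy//.
have -> : h z = c2 * h (z / y).
  by rewrite -E2 ?zy//; congr h; field; rewrite gt_eqF.
by field.
Qed.

(** The range on which [h] is homogeneous with factor [l] depends on [l] at
    first; homogeneity with factor 2 extends it to a range independent of [l]. *)
Lemma conj_scaled_uniform {R : realType} (g h : R -> R) (a d l : R) :
  increasing_conjugacy g h -> 0 < a -> 0 < d <= 1 ->
  (forall x, 0 <= x <= d -> h (2 * x) = a * h x) ->
  0 <= l <= 1 -> scaled_by h l ->
  exists c, forall x, 0 <= x <= d -> h (l * x) = c * h x.
Proof.
move=> ch a0 /andP[d0 d1] hd /andP[l0 l1] [c [e [_ e0 hc]]]; exists c => x /andP[x0 xd].
have up n y : 0 <= y <= d -> h y = a ^+ n * h (y / 2 ^+ n).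
  move=> /andP[y0 yd]; elim: n => [|n IH]; first by rewrite divr1 mul1r.
  have N1 : 1 <= 2 ^+ n.+1 :> R by rewrite exprn_ege1// ler1n.
  have N0 : 0 < 2 ^+ n.+1 :> R by rewrite exprn_gt0.
  rewrite IH exprSr -mulrA -hd; first by congr (_ * h _); rewrite exprSr; field; rewrite expf_neq0.
  rewrite divr_ge0 ?(ltW N0)//= ler_pdivrMr//.
  by rewrite (le_trans yd)// ler_peMr// ltW.
have [n nP] := archimedean_pow2 e0.
have N0 : 0 < 2 ^+ n :> R by rewrite exprn_gt0.
have lxd : 0 <= l * x <= d.
  by rewrite mulr_ge0//= (le_trans _ xd)// ler_piMl.
rewrite (up n _ lxd) (up n x) ?x0//.
have -> : l * x / 2 ^+ n = l * (x / 2 ^+ n) by ring.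
rewrite hc; first by ring.
by rewrite divr_ge0 ?(ltW N0)//= ler_pdivrMr//; lra.
Qed.

(** On the left of [h y] the map [g] is affine, so that [g (h y) - g (h (y - u))]
    is proportional to [h y - h (y - u)]; the former being proportional to
    [h u], so is the latter.  Neither vanishes for [u > 0]. *)
Lemma conj_left_germ {R : realType} (g h : R -> R) (y q e0 : R) :
  increasing_conjugacy g h -> locally_affine g ->
  0 < y <= 1 -> q != 0 -> 0 < e0 ->
  (forall u, 0 <= u <= e0 -> u <= y -> g (h (y - u)) = g (h y) + q * h u) ->
  exists c e, [/\ 0 < c, 0 < e <= y & forall u, 0 <= u <= e -> h (y - u) = h y - c * h u].
Proof.
move=> ch la /andP[y0 y1] q0 e00 gE.
have hy0 : 0 < h y by apply: (conj_gt0 ch); rewrite y0.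
have hy : 0 <= h y <= 1 by apply: (conj_unit ch); lra.
have [|e [s [/andP[e_gt0 e_le1] E]]] := la (h y) (- h y) hy; first lra.
have he0 : 0 < h y * e by rewrite mulr_gt0.
have [d d0 dP] := (within_continuousP h 0 1).1 (conj_cont ch) y ltac:(lra) _ he0.
pose r := Order.min e0 (Order.min y (d / 2)).
have r0 : 0 < r by rewrite /r !lt_min e00 y0 divr_gt0.
have rP u : u <= r -> [/\ u <= e0, u <= y & u <= d / 2].
  by rewrite /r !le_min => /and3P[].
have key u : 0 <= u <= r -> s * ((h y - h (y - u)) / h y) = q * h u.
  move=> /andP[u0 /rP[ue uy ud]].
  have hle : h (y - u) <= h y by apply: (conj_le ch); lra.
  have := dP (y - u) ltac:(lra); rewrite opprB addrC subrK ger0_norm// => /(_ ltac:(lra)).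
  rewrite ger0_norm ?subr_ge0// => hclose.
  have := gE u; rewrite u0 ue => /(_ isT uy).
  have -> : h (y - u) = h y + - h y * ((h y - h (y - u)) / h y).
    by field; rewrite gt_eqF.
  rewrite E; first by move/addrI => <-; congr (s * (_ / _)); field; rewrite gt_eqF.
  rewrite divr_ge0 ?subr_ge0 ?(ltW hy0)//= ler_pdivrMr// mulrC; lra.
have [_ ry _] := rP r (lexx _).
have s0 : s != 0.
  apply/eqP => s0; have := key r; rewrite lexx (ltW r0) s0 mul0r => /(_ isT)/esym/eqP.
  by rewrite mulf_eq0 (negbTE q0)/= gt_eqF// (conj_gt0 ch) ?r0//; lra.
have {}key u : 0 <= u <= r -> h (y - u) = h y - h y * q / s * h u.
  move=> /key E'; have -> : h y * q / s * h u = h y * (q * h u) / s by ring.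
  by rewrite -E'; field; rewrite s0 gt_eqF.
exists (h y * q / s), r; split=> //; last by rewrite r0.
have hr0 : 0 < h r by apply: (conj_gt0 ch); rewrite r0; lra.
have : h (y - r) < h y by apply: (conj_lt ch); lra.
rewrite key ?lexx ?(ltW r0)// ltrBlDr ltrDl.
by rewrite pmulr_lgt0.
Qed.

(** Induction on [n]: at [y = 1] one has [tent (1 - u) = 2 * u], whose image
    under [h] is [a * h u]; at [y = 1 / 2 ^ n.+1] one has
    [tent (y - u) = 1 / 2 ^ n - 2 * u], to which the induction hypothesis
    applies. *)
Lemma conj_fold {R : realType} (g h : R -> R) n :
  increasing_conjugacy g h -> locally_affine g ->
  exists c e, [/\ 0 < c, 0 < e <= 1 / 2 ^+ n &
    forall u, 0 <= u <= e -> h (1 / 2 ^+ n - u) = h (1 / 2 ^+ n) - c * h u].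
Proof.
move=> ch la; have [a [d [a0 /andP[d0 d1] hd]]] := conj_doubling ch la.
elim: n => [|n [c [e [c0 /andP[e0 e1] hc]]]].
  rewrite divr1; apply: (conj_left_germ ch la (q := a) (e0 := d)) => //.
  - by rewrite ltr01 lexx.
  - exact: lt0r_neq0.
  move=> u /andP[u0 ud] u1; rewrite -!(conj_tent ch); [|lra|lra].
  rewrite !tentR; [|lra|lra].
  have -> : 2 - 2 * 1 = 0 :> R by ring.
  have -> : 2 - 2 * (1 - u) = 2 * u by ring.
  by rewrite (conj_0 ch) add0r hd// u0.
have N1 : 1 <= 2 ^+ n :> R by rewrite exprn_ege1// ler1n.
have N0 : 0 < 2 ^+ n :> R by rewrite exprn_gt0.
have yE : 1 / 2 ^+ n = 2 * (1 / 2 ^+ n.+1) :> R by rewrite exprS; field; rewrite gt_eqF.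
have y_le : 1 / 2 ^+ n <= 1 :> R by rewrite ler_pdivrMr// mul1r.
have y_gt : 0 < 1 / 2 ^+ n.+1 :> R by rewrite divr_gt0// exprn_gt0.
rewrite yE in e1 hc y_le; set y := 1 / 2 ^+ n.+1 in e1 hc y_le y_gt *.
apply: (conj_left_germ ch la (q := - (c * a)) (e0 := Order.min d (e / 2))) => //.
- by rewrite y_gt; lra.
- by rewrite oppr_eq0 mulf_neq0// gt_eqF.
- by rewrite lt_min d0 divr_gt0.
move=> u /andP[u0]; rewrite le_min => /andP[ud ue] uy.
rewrite -!(conj_tent ch); [|lra|lra].
rewrite !tentL; [|lra|lra].
rewrite mulrBr hc; last lra.
by rewrite (hd u) ?u0//; ring.
Qed.

(** With [y = 1 / 2 ^ n] small and [u = (1 - l) * y], the number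
    [h (y - (u + v))] equals [h y - c * h (u + v)] by the folding relation at [y],
    and [h (l * y) - c * h v = h y - c * h u - c * h v] by the relation at
    [l * y = y - u], which is the one at [y] rescaled by [l]. *)
Lemma conj_linear_near_0 {R : realType} (g h : R -> R) (m : nat) :
  increasing_conjugacy g h -> locally_affine g ->
  (0 < m)%N -> (forall s, m <> (2 ^ s)%N) -> scaled_by h m%:R ->
  exists2 Y, 0 < Y <= 1 & forall x, 0 <= x <= Y -> h x * Y = h Y * x.
Proof.
move=> ch la m0 mN2 hm; have [a [d [a0 /andP[d0 d1] hd]]] := conj_doubling ch la.
have [n nP] := archimedean_pow2 d0.
have [c [e [c0 ]]] := conj_fold n ch la.
have N0 : 0 < 2 ^+ n :> R by rewrite exprn_gt0.
have yd : 1 / 2 ^+ n <= d by rewrite ler_pdivrMr// ltW.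
have y0 : 0 < 1 / 2 ^+ n :> R by rewrite divr_gt0.
set y := 1 / 2 ^+ n in yd y0 * => /andP[e0 ey] hc.
exists (e / 2); first lra.
apply: linear_of_small_periods; first lra.
  by move=> x z x0 xz ze; apply: (conj_le ch) => //; lra.
move=> r r0.
have r'0 : 0 < Order.min (1 / 2) (Order.min (r / y) (e / 2 / y)).
  by rewrite !lt_min !divr_gt0.
have h2 : scaled_by h 2.
  by exists a, d; rewrite d0 gt_eqF//; split.
have [l /andP[l_gt l1] hl] :=
  quotients_near_1 m0 mN2 h2 hm (@scaled_by_div _ h) r'0.
have {l_gt} : 1 - l < Order.min (1 / 2) (Order.min (r / y) (e / 2 / y)) by lra.
rewrite !lt_min !ltr_pdivlMr// => /and3P[l_gt lr le].
have d01 : 0 < d <= 1 by lra.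
have l01 : 0 <= l <= 1 by lra.
have [c' hc'] := conj_scaled_uniform ch a0 d01 hd l01 hl.
exists ((1 - l) * y).
  by rewrite lr mulr_gt0//; lra.
set u := (1 - l) * y in le *.
have u0 : 0 < u by rewrite mulr_gt0//; lra.
have lyE : l * y = y - u by rewrite /u; ring.
move=> v v0 uv.
have l0 : 0 < l by lra.
have vl : 0 <= v / l <= e.
  by rewrite divr_ge0 ?(ltW l0)//= ler_pdivrMr//; nra.
have E1 : h (y - (u + v)) = h y - c * h (u + v) by apply: hc; lra.
have E2 : h (y - u) = h y - c * h u by apply: hc; lra.
have E3 : h (y - (u + v)) = h (y - u) - c * h v.
  rewrite -lyE.
  have -> : y - (u + v) = l * (y - v / l) by rewrite opprD addrA -lyE; field; rewrite gt_eqF.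
  rewrite !hc'; [|lra|lra].
  rewrite hc//.
  have -> : h v = c' * h (v / l).
    by rewrite -hc'; [congr h; field; rewrite gt_eqF|lra].
  by ring.
have : c * h (u + v) = c * (h u + h v) by lra.
by move/(mulfI (lt0r_neq0 c0)).
Qed.

(** On the unit interval [h x] is the [n]-th iterate of [g] at [h (x / 2 ^ n)],
    and for large [n] the argument [x / 2 ^ n] stays where [h] is linear. *)
Lemma conj_piecewise_linear {R : realType} (g h : R -> R) (Y : R) :
  increasing_conjugacy g h -> locally_affine g ->
  0 < Y <= 1 -> (forall x, 0 <= x <= Y -> h x * Y = h Y * x) ->
  piecewise_linear h.
Proof.
move=> ch la /andP[Y0 Y1] hY; apply: locally_affine_piecewise_linear (conj_cont ch) _.
have [n nP] := archimedean_pow2 Y0.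
have N0 : 0 < 2 ^+ n :> R by rewrite exprn_gt0.
have scaled_unit (x : R) : 0 <= x <= 1 -> 0 <= x / 2 ^+ n <= 1 := @divr_pow2_unit _ n x.
pose F i x := iter i g (h (x / 2 ^+ n)).
have FE i x : 0 <= x <= 1 -> F i x = h (iter i tent (x / 2 ^+ n)).
  move=> /scaled_unit x01; rewrite /F; elim: i => //= i ->.
  rewrite (conj_tent ch)//.
  by apply: (iter_stable (P := fun x => 0 <= x <= 1)) => // *; apply: tent_unit.
have F_unit i x : 0 <= x <= 1 -> 0 <= F i x <= 1.
  move=> x01; rewrite FE//; apply: (conj_unit ch).
  apply: (iter_stable (P := fun x => 0 <= x <= 1)); last exact: scaled_unit.
  by move=> *; apply: tent_unit.
have F_affine i : locally_affine (F i).
  elim: i => [|i IH]; last exact: (locally_affine_comp (F_unit i) IH la).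
  have F0 x : 0 <= x <= 1 -> F 0%N x = h Y / Y / 2 ^+ n * x.
    move=> x01; have /andP[xn0 _] := scaled_unit _ x01.
    have xY : 0 <= x / 2 ^+ n <= Y by rewrite xn0 /= ler_pdivrMr//; lra.
    rewrite /F /=; apply: (mulIf (lt0r_neq0 Y0)); rewrite hY//.
    by field; rewrite !gt_eqF.
  move=> z d z01 zd01; exists 1, (h Y / Y / 2 ^+ n * d); split; first by rewrite ltr01 lexx.
  move=> t t01; rewrite !F0//; first by ring.
  exact: unit_segment.
move=> z d z01 zd01; have [e [s [e01 E]]] := F_affine n z d z01 zd01.
have Fh x : 0 <= x <= 1 -> F n x = h x by move=> x01; rewrite FE// iter_tent_pow2.
exists e, s; split=> // t te; rewrite -!Fh ?E//.
by apply: unit_segment; lra.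
Qed.

(** * The conjugated commutator *)

(** The fixed points of the tent map are 0 and [2 / 3].  The case
    [phi 0 = 2 / 3] is excluded because the tent map reverses orientation there:
    [phi (2 * x)] and [phi x] would lie on different sides of [2 / 3], although
    [phi] is monotone near 0. *)
Lemma tent_commuting_germ {R : realType} (g h phi : R -> R) (p b d : R) :
  increasing_conjugacy g h -> commutes_with_tent phi ->
  {within `[0, 1], continuous phi} ->
  b != 0 -> 0 < d <= 1 -> (forall x, 0 <= x <= d -> h (phi x) = p + b * h x) ->
  0 < b /\ exists2 m : nat, (0 < m)%N & forall x, 0 <= x <= d -> phi x = m%:R * x.
Proof.
move=> ch cphi cont b0 /andP[d0 d1] E; have [phi01 phic] := cphi.
have lt_h x y : 0 <= x <= 1 -> 0 <= y <= 1 -> h x < h y -> x < y.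
  move=> /andP[x0 x1] /andP[y0 y1] hxy; rewrite ltNge; apply/negP => yx.
  by have := conj_le ch y0 yx x1; lra.
have pE : h (phi 0) = p by rewrite E ?lexx ?(ltW d0)// (conj_0 ch) mulr0 addr0.
have h_gt x : 0 < x <= d -> 0 < h x by move=> xd; apply: (conj_gt0 ch); lra.
have phi0_unit : 0 <= phi 0 <= 1 by apply: phi01; lra.
have tent0 : tent 0 = 0 :> R by rewrite tentL; lra.
have fix0 : phi 0 = tent (phi 0) by rewrite -phic ?tent0// lexx ler01.
have [phi0|phi0] : phi 0 = 0 \/ phi 0 = 2 / 3.
  by have [c|/ltW c] := lerP (phi 0) (1 / 2); [left|right]; move: fix0;
    [rewrite tentL//|rewrite tentR//]; lra.
- have p0 : p = 0 by rewrite -pE phi0 (conj_0 ch).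
  have b_gt0 : 0 < b.
    have hd0 := h_gt d ltac:(lra).
    have /andP[] := conj_unit ch (phi01 d ltac:(lra)).
    rewrite E ?(ltW d0) ?lexx// p0 add0r pmulr_lge0// le_eqVlt eq_sym (negbTE b0)/=.
    by [].
  split=> //; apply: tent_commuting_linear => //; first by rewrite d0.
  move=> x y x0 xy yd; apply: lt_h; try by apply: phi01; lra.
  rewrite !E; [|lra|lra]; rewrite ltrD2l ltr_pM2l//.
  by apply: (conj_lt ch); lra.
exfalso.
have e0 : 0 < (1 / 6 : R) by lra.
have [r r0 rP] := (within_continuousP phi 0 1).1 cont 0 ltac:(lra) _ e0.
pose x := Order.min (d / 2) (r / 2).
have x0 : 0 < x by rewrite lt_min !divr_gt0.
have [xd xr] : x <= d / 2 /\ x <= r / 2 by rewrite /x !ge_min !lexx orbT.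
have phix : 1 / 2 <= phi x.
  have := rP x ltac:(lra); rewrite sub0r normrN gtr0_norm// phi0 ltr_norml => /(_ ltac:(lra)).
  by lra.
have phi2x : phi (2 * x) = 2 - 2 * phi x.
  by rewrite -tentR// -phic ?tentL//; lra.
have [E1 E2] : h (phi x) = p + b * h x /\ h (phi (2 * x)) = p + b * h (2 * x).
  by split; apply: E; lra.
have [H1 H2] : 0 < h x /\ 0 < h (2 * x) by split; apply: h_gt; lra.
have [u1 u2] : 0 <= phi x <= 1 /\ 0 <= phi (2 * x) <= 1 by split; apply: phi01; lra.
have [b_lt0|b_gt0|b_eq0] := ltgtP b 0; last by rewrite b_eq0 eqxx in b0.
  have : phi x < phi 0 by apply: lt_h; rewrite // pE E1 gtrDl nmulr_rlt0.
  have : phi (2 * x) < phi 0 by apply: lt_h; rewrite // pE E2 gtrDl nmulr_rlt0.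
  by lra.
have : phi 0 < phi x by apply: lt_h; rewrite // pE E1 ltrDl mulr_gt0.
have : phi 0 < phi (2 * x) by apply: lt_h; rewrite // pE E2 ltrDl mulr_gt0.
by lra.
Qed.

Theorem proposition2 (R : realType) (g h : R -> R)
  (g_unimodal : unimodal g) (g_pl : piecewise_linear g)
  (h_conj : conjugates_tent h g)
  (g_comm : exists psi : R -> R, nontrivial_pl_commutator g psi) :
  piecewise_linear h.
Proof.
have ch := conjugates_tent_increasing g_unimodal h_conj.
have la := piecewise_linear_locally_affine g_pl.
have [psi [[psi01 psi_cont] psi_pl psig nconst niter]] := g_comm.
have [[_ [k [[k01 k_cont] hk kh]]] _] := h_conj.
have k_unit (x : R) : 0 <= x <= 1 -> 0 <= k x <= 1.
  by move=> x01; have := k01 x; rewrite /= !in_itv /=; apply.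
have psi_unit (x : R) : 0 <= x <= 1 -> 0 <= psi x <= 1.
  by move=> x01; have := psi01 x; rewrite /= !in_itv /=; apply.
have g_unit (x : R) : 0 <= x <= 1 -> 0 <= g x <= 1.
  by move=> x01; have := g_unimodal.1.1 x; rewrite /= !in_itv /=; apply.
have {}hk (x : R) : 0 <= x <= 1 -> k (h x) = x by move=> x01; apply: hk; rewrite in_itv.
have {}kh (x : R) : 0 <= x <= 1 -> h (k x) = x by move=> x01; apply: kh; rewrite in_itv.
have {}psig (x : R) : 0 <= x <= 1 -> g (psi x) = psi (g x).
  by move=> x01; apply: psig; rewrite in_itv.
have h_unit := conj_unit ch.
pose phi x := k (psi (h x)).
have hphi x : 0 <= x <= 1 -> h (phi x) = psi (h x).
  by move=> x01; apply/kh/psi_unit/h_unit.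
have phi_tent : commutes_with_tent phi.
  split=> [x x01|x x01]; first by apply/k_unit/psi_unit/h_unit.
  have phix : 0 <= phi x <= 1 by apply/k_unit/psi_unit/h_unit.
  rewrite -[RHS]hk ?tent_unit// (conj_tent ch)// hphi// psig ?h_unit//.
  by rewrite -(conj_tent ch).
have phi_cont : {within `[0, 1], continuous phi}.
  apply: (@within_continuous_unit_comp _ (psi \o h)) => //.
    by move=> x x01; apply/psi_unit/h_unit.
  exact: within_continuous_unit_comp (conj_cont ch) psi_cont.
have psiE y : 0 <= y <= 1 -> psi y = h (phi (k y)).
  by move=> y01; rewrite hphi ?kh// k_unit.
have [b [d [d01 E]]] := conj_germ ch (piecewise_linear_locally_affine psi_pl).
have {}E x : 0 <= x <= d -> h (phi x) = psi 0 + b * h x.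
  by move=> xd; rewrite hphi ?E//; lra.
have phi0_unit : 0 <= phi 0 <= 1 by apply: phi_tent.1; lra.
have [b0|b0] := eqVneq b 0.
  exfalso; apply: nconst; exists (h (phi 0)) => y; rewrite in_itv /= => y01.
  rewrite psiE//; congr h.
  have tent0 : tent 0 = 0 :> R by rewrite tentL; lra.
  apply: (@tent_commuting_eq _ phi (fun=> phi 0) d) => //; [by case/andP: d01| | |exact: k_unit].
    by split=> // x x01; rewrite -phi_tent.2 ?tent0// lexx ler01.
  move=> x xd; rewrite -(hk (phi x)) ?E//; last by apply: phi_tent.1; lra.
  by rewrite -(hk (phi 0))// (E 0) ?b0 ?mul0r//; lra.
have [b_gt0 [m m0 phiE]] := tent_commuting_germ ch phi_tent phi_cont b0 d01 E.
have psi0 : psi 0 = 0.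
  by rewrite -{1}(conj_0 ch) -hphi ?lexx ?ler01// phiE ?mulr0 ?(conj_0 ch)//; lra.
have [[s ms]|m_pow] := pselect (exists s, m = (2 ^ s)%N).
  exfalso; apply: niter; exists s => y; rewrite in_itv /= => y01.
  have N0 : 0 < 2 ^+ s :> R by rewrite exprn_gt0.
  have iter_unit (x : R) : 0 <= x <= 1 -> 0 <= iter s tent x <= 1.
    by apply: (iter_stable (P := fun x => 0 <= x <= 1)) => *; apply: tent_unit.
  have -> : psi y = h (iter s tent (k y)).
    rewrite psiE//; congr h.
    apply: (@tent_commuting_eq _ phi (iter s tent) (Order.min d (1 / 2 ^+ s))).
    - by rewrite lt_min (andP d01).1 divr_gt0.
    - by [].
    - by split=> // x x01; rewrite -iterS iterSr.
    - move=> x /andP[x0]; rewrite le_min ler_pdivlMr// => /andP[xd xs].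
      rewrite phiE ?x0// ms natrX mulrC -{2}[x](mulfK (lt0r_neq0 N0)).
      by rewrite iter_tent_pow2// xs mulr_ge0// ltW.
    - exact: k_unit.
  rewrite -{2}(kh y)//; have := k_unit y y01; elim: s {ms N0 iter_unit} => //= s IH ky.
  rewrite (conj_tent ch) ?IH//.
  by apply: (iter_stable (P := fun x => 0 <= x <= 1)) => // *; apply: tent_unit.
have hm : scaled_by h m%:R.
  exists b, d; split=> //; first by case/andP: d01.
  by move=> x xd; rewrite -phiE// E// psi0 add0r.
have [Y Y01 hY] := conj_linear_near_0 ch la m0 (fun s E => m_pow (ex_intro _ s E)) hm.
exact: conj_piecewise_linear ch la Y01 hY.
Qed.
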